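(* Let $w,h\ge 1$ be odd integers. If $L$ is a hitomezashi loop with width $w$ and height $h$, then $$\operatorname{length}(L)\ \ge\ 4\max\{w,h\}.$$ If $w\ge h$ (respectively, $w\le h$), then equality is achieved if and only if each horizontal (respectively, vertical) stitch in $L$ has the same longitude (respectively, latitude) as exactly one other stitch in $L$.
   Context: A stitch is a unit-length axis-parallel line segment in $\mathbb R^2$ whose endpoints are in $\mathbb Z^2$. A hitomezashi pattern is a collection of stitches such that every point of $\mathbb Z^2$ is an endpoint of exactly one horizontal stitch and exactly one vertical stitch of the collection. A hitomezashi loop is a bounded connected component of the union of the stitches of a hitomezashi pattern (it is a closed polygon). The longitude (respectively, latitude) of a stitch is the $x$-coordinate (respectively, $y$-coordinate) of its midpoint. The width (respectively, height) of a hitomezashi loop $L$ is the maximum difference between the longitudes (respectively, latitudes) of the stitches in $L$. $\operatorname{length}(L)$ is the number of stitches in $L$. *)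

(* Defs.v *)
(* The plane is R * R for an arbitrary realType R. *)
From mathcomp Require Import all_boot all_order all_algebra finmap.
From mathcomp Require Import all_classical all_reals all_analysis.

Set Implicit Arguments.
Unset Strict Implicit.
Unset Printing Implicit Defensive.

Import Order.TTheory GRing.Theory Num.Theory.
Import numFieldNormedType.Exports.

Local Open Scope classical_set_scope.
Local Open Scope ring_scope.

(* ((a, b), true) is the horizontal unit segment from (a, b) to (a + 1, b),
   and ((a, b), false) the vertical one from (a, b) to (a, b + 1). *)
Definition stitch : Type := (int * int * bool)%type.

Definition horizontal (s : stitch) : bool := s.2.
Definition vertical (s : stitch) : bool := ~~ s.2.

Definition source (s : stitch) : int * int := s.1.
Definition target (s : stitch) : int * int :=
  if horizontal s then (s.1.1 + 1, s.1.2) else (s.1.1, s.1.2 + 1).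

Definition endpoint (z : int * int) (s : stitch) : Prop :=
  z = source s \/ z = target s.

Definition hitomezashi_pattern (P : set stitch) : Prop :=
  forall z : int * int,
    (exists! s, [/\ P s, horizontal s & endpoint z s]) /\
    (exists! s, [/\ P s, vertical s & endpoint z s]).

(* Since the segment is axis-parallel, it is the box spanned by its
   endpoints, one of whose sides is degenerate. *)
Definition segment (R : realType) (s : stitch) : set (R * R) :=
  [set p | (source s).1%:~R <= p.1 <= (target s).1%:~R /\
           (source s).2%:~R <= p.2 <= (target s).2%:~R].
Arguments segment R s : clear implicits.

Definition stitch_union (R : realType) (P : set stitch) : set (R * R) :=
  \bigcup_(s in P) segment R s.
Arguments stitch_union R P : clear implicits.

Definition hitomezashi_loop (R : realType) (L : set (R * R)) : Prop :=
  exists P : set stitch, hitomezashi_pattern P /\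
    bounded_set L /\
    exists2 p, stitch_union R P p &
      L = connected_component (stitch_union R P) p.

(* Two different lattice unit segments share at most an endpoint, so for a loop
   of a pattern P these are exactly the members of P that make up the loop. *)
Definition stitches_of (R : realType) (L : set (R * R)) : set stitch :=
  [set s | segment R s `<=` L].

Definition longitude (R : realType) (s : stitch) : R :=
  ((source s).1%:~R + (target s).1%:~R) / 2.
Arguments longitude R s : clear implicits.

Definition latitude (R : realType) (s : stitch) : R :=
  ((source s).2%:~R + (target s).2%:~R) / 2.
Arguments latitude R s : clear implicits.

Definition is_maximum (R : realType) (A : set R) (m : R) : Prop :=
  A m /\ ubound A m.

Definition has_width (R : realType) (L : set (R * R)) (w : R) : Prop :=
  is_maximum [set longitude R st.1 - longitude R st.2
             | st in stitches_of L `*` stitches_of L] w.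
Definition has_height (R : realType) (L : set (R * R)) (h : R) : Prop :=
  is_maximum [set latitude R st.1 - latitude R st.2
             | st in stitches_of L `*` stitches_of L] h.

(* fset_set is junk on infinite sets, but a bounded set contains only finitely
   many stitches. *)
Definition loop_length (R : realType) (L : set (R * R)) : nat :=
  #|` fset_set (stitches_of L)|%fset.

(* Main.v *)
Require Import Defs.
From mathcomp Require Import all_boot all_order all_algebra finmap.
From mathcomp Require Import all_classical all_reals all_analysis.
From mathcomp Require Import zify ring lra.

Import Order.TTheory GRing.Theory Num.Theory.
Import numFieldNormedType.Exports.

Local Open Scope classical_set_scope.
Local Open Scope ring_scope.

(** The two orientations play symmetric roles, so everything is done for a
    direction o, which is at once an orientation of stitches and a coordinate
    of the plane; a column is the set of stitches of orientation o whose source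
    has a given o-coordinate, that is, those that cross a given line
    perpendicular to o at a half-integer.

    A loop has one stitch of each orientation at each of its vertices.  Counting
    vertices through the ends of the stitches of one orientation or of the other
    gives the same number; over all vertices this says that half of the stitches
    have orientation o ([size_two_regular]), and over the vertices on one side
    of a line it says that the line is crossed an even number of times
    ([even_crossings]).  A loop is connected, so that every line perpendicular to
    o at a half-integer between the two extreme stitches is crossed
    ([extent_columns]), hence at least twice.  If the extent along o is m,
    there are m such lines, so at least 2m stitches of orientation o, so at least
    4m stitches, with equality exactly when each line is crossed just twice
    ([size_occupied_columns]).  Applied to both directions, this gives the lower
    bound by the maximum, and applied to the larger extent, the equality case.

    What remains is to pass from the topological definition of a loop to this
    combinatorial picture.  A segment is connected, so the component contains any
    stitch of the pattern that it meets; conversely a lattice segment that lies in the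
    component is a stitch of the pattern because its midpoint lies on no
    other lattice segment ([loop_stitchesP]). *)

(** * Coordinates along a direction *)

Lemma negb_eqF (b : bool) : (~~ b == b) = false.
Proof. by case: b. Qed.

Definition coord {T : Type} (o : bool) (z : T * T) : T := if o then z.1 else z.2.

Lemma coord_target (o : bool) (s : stitch) :
  coord o (target s) = coord o (source s) + (s.2 == o)%:Z.
Proof.
case: s => [[a b] k]; rewrite /coord /target /source /horizontal /=.
by case: o; case: k; rewrite ?addr0.
Qed.

Lemma source_target (s : stitch) : (source s == target s) = false.
Proof.
apply/negbTE/eqP => st; have := coord_target s.2 s.
by rewrite -st eqxx; lia.
Qed.

(** * Double counting in two-regular sequences of stitches *)

Definition incident (z : int * int) (s : stitch) : bool :=
  (z == source s) || (z == target s).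

Lemma incidentP (z : int * int) (s : stitch) :
  reflect (endpoint z s) (incident z s).
Proof. by apply: (iffP orP) => -[/eqP|/eqP]; by [left | right]. Qed.

Lemma incidentE (z : int * int) (s : stitch) :
  incident z s = ((z == source s) + (z == target s))%N :> nat.
Proof.
by rewrite /incident; case: eqVneq => // ->; rewrite source_target.
Qed.

(** At each visited vertex the stitches of e have exactly one representative of
    each orientation: this is all that the counting arguments use of a loop. *)
Definition two_regular (e : seq stitch) : Prop :=
  forall s z o, s \in e -> endpoint z s ->
    count (fun t : stitch => (t.2 == o) && incident z t) e = 1%N.

(** Both sides count the visited vertices that satisfy q: each is the end of
    exactly one stitch of orientation o.  The right-hand side does not depend on
    o, which is what the two corollaries below exploit. *)
Lemma sum_marked_ends (e : seq stitch) (q : pred (int * int)) (o : bool) :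
  two_regular e ->
  (\sum_(s <- e | s.2 == o) (q (source s) + q (target s)))%N =
  count q (undup (map source e ++ map target e)).
Proof.
move=> reg; set U := undup _.
have UP z : z \in U -> exists2 s, s \in e & endpoint z s.
  rewrite mem_undup mem_cat => /orP[] /mapP[s se ->]; exists s => //.
    by left.
  by right.
have one z : z \in U -> 1%N = (\sum_(t <- e | t.2 == o) incident z t)%N.
  by move=> /UP[s se /(reg s z o se)]; rewrite -big_mkcondr sum1_count.
(* U has no repetition, so v occurs in it exactly once. *)
have pick v : v \in U -> (\sum_(z <- U | q z) (z == v))%N = q v.
  move=> vU; rewrite -big_mkcondr /= sum1_count.
  case qv: (q v).
    rewrite (eq_count (a2 := pred1 v)) ?count_uniq_mem ?undup_uniq ?vU//.
    by move=> z /=; case: (eqVneq z v) => [->|]; rewrite ?qv ?andbF.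
  rewrite (eq_count (a2 := pred0)) ?count_pred0//.
  by move=> z /=; case: (eqVneq z v) => [->|]; rewrite ?qv ?andbF.
rewrite -sum1_count -[RHS]big_filter.
rewrite (eq_big_seq (fun z => \sum_(t <- e | t.2 == o) incident z t)%N); last first.
  by move=> z; rewrite mem_filter => /andP[_ /one].
rewrite big_filter exchange_big /= big_seq_cond [RHS]big_seq_cond.
apply: eq_bigr => s /andP[se _].
under [RHS]eq_bigr do rewrite incidentE.
by rewrite big_split /= !pick// mem_undup mem_cat map_f ?orbT.
Qed.

(** Marking every vertex, each stitch has two marked ends, so there are as many
    stitches of one orientation as of the other. *)
Lemma size_two_regular (e : seq stitch) (o : bool) : two_regular e ->
  size e = (2 * count (fun s : stitch => s.2 == o) e)%N.
Proof.
move=> reg.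
have := sum_marked_ends e predT (~~ o) reg; rewrite -(sum_marked_ends e predT o reg).
rewrite /= !big_const_seq !iter_addn_0.
rewrite (eq_count (a1 := fun s : stitch => s.2 == ~~ o)
  (a2 := predC (fun s : stitch => s.2 == o))); last first.
  by move=> s /=; case: (s.2); case: (o).
by rewrite -(count_predC (fun s : stitch => s.2 == o) e) => /=; lia.
Qed.

(** Mark the vertices with o-coordinate at most c.  A stitch of the other
    orientation has both ends marked or none, so the number of marked vertices is
    even; among those of orientation o, exactly the ones of this column have a
    single marked end. *)
Lemma even_crossings (e : seq stitch) (o : bool) (c : int) : two_regular e ->
  ~~ odd (count (fun s : stitch => (s.2 == o) && (coord o (source s) == c)) e).
Proof.
move=> reg; set q := fun z : int * int => coord o z <= c.
have := sum_marked_ends e q o reg; rewrite -(sum_marked_ends e q (~~ o) reg).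
rewrite (eq_bigr (fun s : stitch =>
   (coord o (source s) == c) + 2 * (coord o (source s) < c)%R)%N); last first.
  move=> s /eqP so; rewrite /q coord_target so eqxx.
  by case: (ltgtP (coord o (source s)) c) => ? /=; lia.
rewrite [RHS](eq_bigr (fun s : stitch => (2 * q (source s))%N)); last first.
  move=> s /eqP so; rewrite /q coord_target so.
  by rewrite negb_eqF addr0 mul2n addnn.
rewrite big_split /= -!big_distrr /= -big_mkcondr /= sum1_count.
by move=> H; apply/negP; lia.
Qed.

(** A nonempty column has at least two stitches by parity; half of the stitches
    of e lie in the columns, so the size is twice the sum of m numbers that are
    all at least 2. *)
Lemma size_occupied_columns (e : seq stitch) (o : bool) (m : nat) (x0 : int) :
  (0 < m)%N -> two_regular e ->
  (forall s, s \in e -> s.2 == o -> x0 <= coord o (source s) < x0 + m%:Z) ->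
  (forall c, x0 <= c < x0 + m%:Z ->
     has (fun s : stitch => (s.2 == o) && (coord o (source s) == c)) e) ->
  (4 * m <= size e)%N /\
  (size e = (4 * m)%N <->
   forall s, s \in e -> s.2 == o ->
     count (fun t : stitch =>
       (t.2 == o) && (coord o (source t) == coord o (source s))) e = 2%N).
Proof.
case: m => [//|m] _ reg box col.
pose N (i : 'I_m.+1) :=
  count (fun s : stitch => (s.2 == o) && (coord o (source s) == x0 + i%:Z)) e.
have colP (i : 'I_m.+1) : x0 <= x0 + i%:Z < x0 + m.+1%:Z.
  by have := ltn_ord i; lia.
have N2 i : (2 <= N i)%N.
  have := even_crossings e o (x0 + i%:Z) reg; have := col _ (colP i).
  by rewrite has_count -/(N i); lia.
have sizeE : size e = (2 * \sum_(i < m.+1) N i)%N.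
  rewrite (size_two_regular e o reg) -sum1_count.
  rewrite (@partition_big _ _ _ _ _ 'I_m.+1 _
    (fun s : stitch => inord `|coord o (source s) - x0|%N) xpredT)//=.
  congr (2 * _)%N; apply: eq_bigr => i _.
  rewrite sum1_count /N; apply: eq_in_count => s se /=.
  have [so|//] := boolP (s.2 == o); have := box s se so => /= ?.
  by rewrite -val_eqE /= inordK; lia.
have sumE : (4 * m.+1 = 2 * \sum_(i < m.+1) 2)%N.
  by rewrite sum_nat_const card_ord; lia.
split.
  by rewrite sizeE sumE leq_pmul2l// leq_sum.
split=> [|all2].
  rewrite sizeE sumE => /eqP; rewrite eqn_pmul2l// eq_sym => eq2 s se so.
  (* A sum of terms at least 2 is minimal only if each term is 2. *)
  have [_] := @leqif_sum _ xpredT (fun i => 2%N == N i) (fun=> 2%N) N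
    (fun i _ => leqif_eq (N2 i)).
  rewrite eq2 => /esym/forallP/= N2E; have := box s se so => ?.
  have lt_i : (`|coord o (source s) - x0| < m.+1)%N by lia.
  rewrite [RHS](eqP (N2E (Ordinal lt_i))) /N; congr count; apply/funext => t /=.
  by congr (_ && (_ == _)); lia.
rewrite sizeE sumE; congr (2 * _)%N; apply: eq_bigr => i _.
have /hasP[s se /andP[so /eqP sc]] := col _ (colP i).
by have := all2 s se so; rewrite sc.
Qed.

(** * Counting and unique existence *)

Lemma count_uniq1 (T : eqType) (e : seq T) (p : pred T) : uniq e ->
  (count p e = 1%N <-> exists! t : T, t \in e /\ p t).
Proof.
move=> ue; rewrite -size_filter; have := filter_uniq p ue.
have fP (t : T) : t \in seq.filter p e <-> t \in e /\ p t.
  by rewrite mem_filter; split=> [/andP[]|[-> ->]].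
case: (seq.filter p e) fP => [|t f] fP uf; split=> //=.
- by case=> t [/fP].
- case: f fP uf => // fP _ _; exists t; split; first by apply/fP; rewrite inE.
  by move=> u /fP; rewrite inE => /eqP.
- case=> u [_ uu]; case: f fP uf => // v f fP; rewrite /= inE.
  have ut : u = t by apply/uu/fP; rewrite inE eqxx.
  have uv : u = v by apply/uu/fP; rewrite !inE eqxx orbT.
  by rewrite -ut -uv eqxx.
Qed.

Lemma count_uniq2 (T : eqType) (e : seq T) (p : pred T) (s : T) : uniq e ->
  s \in e -> p s ->
  (count p e = 2%N <-> exists! t : T, t \in e /\ (t != s) && p t).
Proof.
move=> ue se ps; rewrite -count_uniq1//.
have -> : count (fun t : T => (t != s) && p t) e = count p (rem s e).
  by rewrite rem_filter// count_filter; apply: eq_count => t /=; rewrite andbC.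
have : (0 < count p e)%N by rewrite -has_count; apply/hasP; exists s.
by rewrite count_rem se ps /=; lia.
Qed.

(** * Segments in the plane *)

Definition real_point (R : realType) (z : int * int) : R * R :=
  (z.1%:~R, z.2%:~R).
Arguments real_point R z : clear implicits.

Lemma coord_real_point (R : realType) (o : bool) (z : int * int) :
  coord o (real_point R z) = (coord o z)%:~R.
Proof. by case: o. Qed.

(** Describes a segment one coordinate at a time, so that later arguments need
    not distinguish the two orientations. *)
Lemma segment_coordP (R : realType) (s : stitch) (p : R * R) :
  segment R s p <-> forall o : bool,
    (coord o (source s))%:~R <= coord o p
      <= (coord o (source s))%:~R + (s.2 == o)%:R.
Proof.
have tE o : (coord o (target s))%:~R =
    (coord o (source s))%:~R + (s.2 == o)%:R :> R.
  by rewrite coord_target rmorphD /= -pmulrn.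
split=> [[p1 p2] o|sp].
  by rewrite -tE; case: o.
by split; [have := sp true | have := sp false]; rewrite -tE.
Qed.

Lemma endpoint_segment (R : realType) (s : stitch) (z : int * int) :
  endpoint z s -> segment R s (real_point R z).
Proof.
move=> zs; apply/segment_coordP => o; rewrite coord_real_point.
case: zs => ->; first by rewrite lexx lerDl ler0n.
by rewrite coord_target rmorphD /= -pmulrn lexx lerDl ler0n.
Qed.

(** An o-coordinate that is a half-integer forces both the orientation and the
    column: across o a segment has a constant integer coordinate. *)
Lemma half_coord_segment (R : realType) (s : stitch) (p : R * R) (o : bool)
    (c : int) : segment R s p -> coord o p = c%:~R + 2^-1 ->
  s.2 = o /\ coord o (source s) = c.
Proof.
move=> /segment_coordP/(_ o) /andP[lo hi] pc; rewrite pc in lo hi.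
have le_c : coord o (source s) <= c.
  by rewrite -ltzD1 -(ltr_int R) rmorphD /=; lra.
have [so|sno] := eqVneq s.2 o; last first.
  move: hi; rewrite (negbTE sno) addr0.
  by move: le_c; rewrite -(ler_int R) => ? ?; exfalso; lra.
split=> //; apply/eqP; rewrite eq_le le_c -ltzD1 -(ltr_int R) rmorphD /=.
by move: hi; rewrite so eqxx /= => ?; lra.
Qed.

Definition midpoint (R : realType) (s : stitch) : R * R :=
  (longitude R s, latitude R s).

Lemma coord_midpoint (R : realType) (s : stitch) (o : bool) :
  coord o (midpoint R s) = (coord o (source s))%:~R + (s.2 == o)%:R / 2.
Proof.
have -> : coord o (midpoint R s) =
    ((coord o (source s))%:~R + (coord o (target s))%:~R) / 2 by case: o.
by rewrite coord_target rmorphD /= -pmulrn; field.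
Qed.

Lemma midpoint_in_segment (R : realType) (s : stitch) : segment R s (midpoint R s).
Proof.
apply/segment_coordP => o; rewrite coord_midpoint.
by case: (s.2 == o) => /=; apply/andP; split; lra.
Qed.

(** The midpoint has a half-integer coordinate along the orientation of s, which
    determines the orientation and the column of t; across it, t has a constant
    coordinate. *)
Lemma midpoint_segment_inj (R : realType) (s t : stitch) :
  segment R t (midpoint R s) -> t = s.
Proof.
move=> ts.
have [t2 tc] : t.2 = s.2 /\ coord s.2 (source t) = coord s.2 (source s).
  apply: half_coord_segment ts _.
  by rewrite coord_midpoint eqxx mul1r.
have tc' : coord (~~ s.2) (source t) = coord (~~ s.2) (source s).
  move/segment_coordP: ts => /(_ (~~ s.2)).
  rewrite coord_midpoint t2 eq_sym negb_eqF.
  by rewrite mul0r !addr0 -eq_le eqr_int => /eqP.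
move: s t t2 tc tc' {ts} => [[a b] k] [[a' b'] k'] /= -> {k'}.
by rewrite /source /coord /=; case: k => /= -> ->.
Qed.

Lemma segment_is_connected (R : realType) (s : stitch) : connected (segment R s).
Proof.
pose f (x : R) : R * R :=
  if s.2 then (x, (source s).2%:~R) else ((source s).1%:~R, x).
have -> : segment R s =
    f @` `[(coord s.2 (source s))%:~R, (coord s.2 (source s))%:~R + 1].
  apply/seteqP; split=> [p /segment_coordP sp|_ [x xs <-]]; last first.
    apply/segment_coordP => o; move: xs; rewrite /= in_itv/= /f.
    case: (s) => [[a b] k]; rewrite /source /coord /=.
    by case: k; case: o => /= /andP[? ?]; apply/andP; split; lra.
  exists (coord s.2 p); first by move: (sp s.2); rewrite eqxx /= in_itv.
  move: (sp (~~ s.2)); rewrite /f eq_sym negb_eqF.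
  rewrite addr0 -eq_le => /eqP.
  by case: (s) => [[a b] []]; case: (p) => p1 p2; rewrite /source /coord /= => ->.
apply: connected_continuous_connected; first exact: segment_connected.
apply: continuous_subspaceT => x; rewrite /f.
rewrite /continuous_at; case: s.2.
  refine (cvg_pair (F := nbhs x) (G := nbhs x)
    (H := nbhs ((source s).2%:~R : R)) _ _); [exact: cvg_id | exact: cvg_cst].
refine (cvg_pair (F := nbhs x) (G := nbhs ((source s).1%:~R : R))
  (H := nbhs x) _ _); [exact: cvg_cst | exact: cvg_id].
Qed.

Lemma coord_continuous (R : realType) (o : bool) :
  continuous (coord o : R * R -> R).
Proof. by case: o => -[x y]; [exact: cvg_fst | exact: cvg_snd]. Qed.

(** * The stitches of a loop *)

Lemma loop_connected (R : realType) (L : set (R * R)) :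
  hitomezashi_loop L -> connected L.
Proof. by case=> P [_ [_ [p _ ->]]]; exact: component_connected. Qed.

(** The dictionary between the component and the pattern.  Membership in P comes
    from the midpoint, which lies in a single lattice segment; the last clause
    from the connectedness of a segment together with the maximality of the
    component. *)
Lemma loop_stitchesP (R : realType) (L : set (R * R)) : hitomezashi_loop L ->
  exists2 P : set stitch, hitomezashi_pattern P &
    [/\ stitches_of L `<=` P,
        forall p, L p -> exists2 s, P s & segment R s p &
        forall s p, P s -> L p -> segment R s p -> stitches_of L s].
Proof.
case=> P [patP [_ [p0 Pp0 LE]]]; exists P => //.
have LP p : L p -> exists2 s, P s & segment R s p.
  by rewrite LE => /connected_component_sub.
split=> //.
  move=> s sL; have [t Pt] := LP _ (sL _ (midpoint_in_segment R s)).
  by move/midpoint_segment_inj => <-.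
move=> s p Ps Lp sp; rewrite /stitches_of /= LE.
rewrite (same_connected_component (y := p)); last by rewrite -LE.
apply: connected_component_max => //; last exact: segment_is_connected.
by move=> q sq; exists s.
Qed.

Lemma stitch_through (R : realType) (L : set (R * R)) (p : R * R) :
  hitomezashi_loop L -> L p -> exists2 s, stitches_of L s & segment R s p.
Proof.
move=> /loop_stitchesP[P _ [_ LP PL]] Lp.
by have [s Ps sp] := LP p Lp; exists s => //; exact: PL Lp sp.
Qed.

Lemma stitch_at_endpoint (R : realType) (L : set (R * R)) (s : stitch)
    (z : int * int) (o : bool) :
  hitomezashi_loop L -> stitches_of L s -> endpoint z s ->
  exists! t, [/\ stitches_of L t, t.2 = o & endpoint z t].
Proof.
move=> /loop_stitchesP[P patP [SP LP PL]] Ls zs.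
have Lz : L (real_point R z) by apply: Ls; exact: endpoint_segment.
have [t [[Pt to tz] tu]] : exists! t, [/\ P t, t.2 = o & endpoint z t].
  have [[t [[Pt th tz] tu]] [u [[Pu uh uz] uu]]] := patP z.
  case: o.
    by exists t; split=> // v [Pv vo vz]; apply: tu; split; rewrite // /horizontal.
  exists u; split; first by split=> //; exact/negbTE.
  by move=> v [Pv vo vz]; apply: uu; split; rewrite // /vertical vo.
exists t; split; first by split=> //; apply: PL Lz _; rewrite //; exact: endpoint_segment.
by move=> v [Lv vo vz]; apply: tu; split=> //; exact: SP.
Qed.

(** A bounded set meets the sources of stitches in a square grid, whose indices
    are shifted by N below to make them natural numbers. *)
Lemma stitches_finite (R : realType) (L : set (R * R)) :
  hitomezashi_loop L -> finite_set (stitches_of L).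
Proof.
case=> P [_ [[M [_ LM]] _]].
have {}LM p o : L p -> `|coord o p| <= M + 1.
  move=> /(LM (M + 1) _ p); rewrite ltrDl ltr01 => /(_ isT) pM.
  have : Num.max `|p.1| `|p.2| <= M + 1 by exact: pM.
  by rewrite ge_max => /andP[]; case: o.
pose N := Num.bound (M + 1).
have LN s o : stitches_of L s -> `|coord o (source s)| <= N%:Z.
  move=> sL; rewrite -(ler_int R) intr_norm.
  have := LM (real_point R (source s)) o.
  rewrite coord_real_point => sM.
  have {}sM := sM (sL _ (endpoint_segment R s _ (or_introl erefl))).
  apply: le_trans (sM) _; apply/ltW/archi_boundP.
  exact: le_trans (normr_ge0 _) sM.
pose f (ijk : 'I_(2 * N).+1 * 'I_(2 * N).+1 * bool) : stitch :=
  (((ijk.1.1 : nat)%:Z - N%:Z, (ijk.1.2 : nat)%:Z - N%:Z), ijk.2).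
apply: (@sub_finite_set _ _ (f @` setT)); last exact/finite_image/finite_finset.
move=> s sL; have := LN s true sL; have := LN s false sL.
case: s sL => [[a b] k] _; rewrite /source /coord /= => bN aN.
exists (inord `|a + N%:Z|, inord `|b + N%:Z|, k) => //.
by rewrite /f /= !inordK; [congr (_, _, _); lia | lia | lia].
Qed.

Lemma fset_stitchesP (R : realType) (L : set (R * R)) (s : stitch) :
  hitomezashi_loop L -> s \in fset_set (stitches_of L) <-> stitches_of L s.
Proof. by move=> Lloop; rewrite in_fset_set ?inE//; exact: stitches_finite. Qed.

Lemma stitches_two_regular (R : realType) (L : set (R * R)) :
  hitomezashi_loop L -> two_regular (fset_set (stitches_of L)).
Proof.
move=> Lloop s z o /(fset_stitchesP _ _ _ Lloop) sL zs.
apply/count_uniq1; first exact: fset_uniq.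
have [t [[tL to tz] tu]] := stitch_at_endpoint R L s z o Lloop sL zs.
exists t; split.
  by split; [apply/fset_stitchesP | rewrite to eqxx; apply/incidentP].
move=> v [/(fset_stitchesP _ _ _ Lloop) vL /andP[/eqP vo /incidentP vz]].
by apply: tu.
Qed.

(** * The extent of a loop along a direction *)

(** The width is the extent along true and the height the extent along false, up
    to conversion. *)
Definition extent (R : realType) (o : bool) (L : set (R * R)) (m : R) : Prop :=
  is_maximum [set coord o (midpoint R st.1) - coord o (midpoint R st.2)
             | st in stitches_of L `*` stitches_of L] m.

(** The extreme stitches t and s are perpendicular to o: otherwise the loop would
    go on, through a perpendicular stitch, half a unit further.  So they lie at
    integer coordinates, m apart, and every column between them is occupied
    because the projection of the connected set L to an axis is an interval. *)
Lemma extent_columns (R : realType) (o : bool) (L : set (R * R)) (m : nat) :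
  hitomezashi_loop L -> extent R o L m%:R ->
  exists x0 : int,
    (forall s, stitches_of L s -> s.2 = o ->
       x0 <= coord o (source s) < x0 + m%:Z) /\
    (forall c, x0 <= c < x0 + m%:Z ->
       exists s, [/\ stitches_of L s, s.2 = o & coord o (source s) = c]).
Proof.
move=> Lloop [[[t s] /= [tL sL] tsm] maxm].
have {}maxm u v : stitches_of L u -> stitches_of L v ->
    coord o (midpoint R u) - coord o (midpoint R v) <= m%:R.
  by move=> uL vL; apply: maxm; exists (u, v).
(* At a vertex z the loop has a stitch perpendicular to o, whose midpoint has
   the o-coordinate of z itself. *)
have cross u z : stitches_of L u -> endpoint z u ->
    exists2 v, stitches_of L v & coord o (midpoint R v) = (coord o z)%:~R.
  move=> uL zu.
  have [v [[vL vo vz] _]] := stitch_at_endpoint R L u z (~~ o) Lloop uL zu.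
  exists v => //; rewrite coord_midpoint vo negb_eqF.
  case: vz => ->; first by rewrite mul0r addr0.
  by rewrite coord_target vo negb_eqF mul0r !addr0.
have to : t.2 == o = false.
  apply/negP => to.
  have [v vL vE] := cross t (target t) tL (or_intror erefl).
  have := maxm v s vL sL; rewrite -tsm vE [coord o (midpoint R t)]coord_midpoint.
  by rewrite coord_target to rmorphD /= => ?; lra.
have so : s.2 == o = false.
  apply/negP => so.
  have [v vL vE] := cross s (source s) sL (or_introl erefl).
  have := maxm t v tL vL; rewrite -tsm vE [coord o (midpoint R s)]coord_midpoint so /=.
  by move=> ?; lra.
set x0 := coord o (source s); set x1 := coord o (source t).
rewrite !coord_midpoint to so !mul0r !addr0 -/x0 -/x1 in tsm.
have x1E : x1 = x0 + m%:Z.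
  by apply/eqP; rewrite -(eqr_int R) rmorphD /= -pmulrn -tsm; apply/eqP; lra.
exists x0; rewrite -x1E; split.
  move=> u uL uo.
  have [v vL vE] := cross u (target u) uL (or_intror erefl).
  have [w wL wE] := cross u (source u) uL (or_introl erefl).
  have := maxm v s vL sL; have := maxm t w tL wL.
  rewrite -tsm vE wE !coord_midpoint to so !mul0r !addr0 -/x0 -/x1.
  rewrite coord_target uo eqxx rmorphD /= => lo hi.
  by apply/andP; split; rewrite -?lezD1 -(ler_int R) ?rmorphD /=; lra.
move=> c /andP[x0c cx1].
(* Halfway across the column c only a stitch of orientation o, with source in
   this column, can pass. *)
have [p Lp pc] : exists2 p, L p & coord o p = c%:~R + 2^-1.
  have itvL : is_interval (coord o @` L).
    apply/connected_intervalP/connected_continuous_connected.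
      exact: loop_connected.
    by apply: continuous_subspaceT; exact: coord_continuous.
  have [] := itvL x0%:~R x1%:~R _ _ (c%:~R + 2^-1).
  - exists (midpoint R s); first by apply: sL; exact: midpoint_in_segment.
    by rewrite coord_midpoint so mul0r addr0.
  - exists (midpoint R t); first by apply: tL; exact: midpoint_in_segment.
    by rewrite coord_midpoint to mul0r addr0.
  - by move: x0c cx1; rewrite -lezD1 -!(ler_int R) rmorphD /=; lra.
  by move=> p Lp pE; exists p.
have [u uL up] := stitch_through R L p Lloop Lp.
have [uo uc] := half_coord_segment R u p o c up pc.
by exists u.
Qed.

(** A stitch of orientation o has a half-integer o-coordinate at its midpoint and
    the others an integer one, so sharing the longitude (or latitude) of a
    stitch along o means lying in the same column. *)
Lemma eq_coord_midpoint (R : realType) (o : bool) (s t : stitch) : s.2 = o ->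
  coord o (midpoint R t) = coord o (midpoint R s) <->
  t.2 = o /\ coord o (source t) = coord o (source s).
Proof.
move=> so; rewrite [coord o (midpoint R s)]coord_midpoint so eqxx.
split=> [tE|[to tc]]; last by rewrite coord_midpoint to tc eqxx.
apply: half_coord_segment (midpoint_in_segment R t) _.
by rewrite tE mul1r.
Qed.

(** Transfers the count from columns to midpoints: a column of size two is one in
    which each stitch has exactly one companion. *)
Lemma length_extent (R : realType) (o : bool) (L : set (R * R)) (m : nat) :
  (0 < m)%N -> hitomezashi_loop L -> extent R o L m%:R ->
  (4 * m <= loop_length L)%N /\
  (loop_length L = (4 * m)%N <->
   forall s, stitches_of L s -> s.2 = o ->
     exists! t, [/\ stitches_of L t, t <> s &
                    coord o (midpoint R t) = coord o (midpoint R s)]).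
Proof.
move=> m0 Lloop Lm; have [x0 [box col]] := extent_columns R o L m Lloop Lm.
set e := fset_set (stitches_of L).
have eP s : s \in e <-> stitches_of L s by exact: fset_stitchesP.
have [|c|le4 eq4] := size_occupied_columns e o m x0 m0 (stitches_two_regular R L Lloop).
- by move=> s /eP sL /eqP; exact: box.
- move=> /col[s [sL so sc]]; apply/hasP; exists s; first exact/eP.
  by rewrite so sc !eqxx.
split=> //; rewrite /loop_length -/e eq4.
split=> H s.
  move=> sL so; have se : s \in e by exact/eP.
  have := H s se; rewrite so eqxx => /(_ isT).
  move/(count_uniq2 _ _ _ s (fset_uniq e) se) => /=.
  rewrite so !eqxx => /(_ isT) [t [[te /and3P[ts to tc]] tu]]; exists t; split.
    split; [exact/eP | exact/eqP |].
    by apply/eq_coord_midpoint => //; split; exact/eqP.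
  move=> v [vL vs /(eq_coord_midpoint _ _ _ _ so) [vo vc]]; apply: tu.
  by split; [exact/eP | rewrite vo vc !eqxx !andbT; exact/eqP].
move=> se /eqP so; have sL : stitches_of L s by exact/eP.
apply/(count_uniq2 _ _ _ s (fset_uniq e) se); first by rewrite so !eqxx.
have [t [[tL ts /(eq_coord_midpoint _ _ _ _ so) [to tc]] tu]] := H s sL so.
exists t; split.
  by split; [exact/eP | rewrite to tc !eqxx !andbT; exact/eqP].
move=> v [/eP vL /and3P[/eqP vs /eqP vo /eqP vc]]; apply: tu; split=> //.
by apply/eq_coord_midpoint.
Qed.

Theorem theorem2p4 (R : realType) (w h : nat) (L : set (R * R))
    (w_ge1 : (1 <= w)%N) (h_ge1 : (1 <= h)%N) (w_odd : odd w) (h_odd : odd h)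
    (L_loop : hitomezashi_loop L)
    (L_width : has_width L w%:R) (L_height : has_height L h%:R) :
  (4 * maxn w h <= loop_length L)%N /\
  ((h <= w)%N ->
    (loop_length L = (4 * maxn w h)%N <->
     forall s, stitches_of L s -> horizontal s ->
       exists! t, [/\ stitches_of L t, t <> s & longitude R t = longitude R s])) /\
  ((w <= h)%N ->
    (loop_length L = (4 * maxn w h)%N <->
     forall s, stitches_of L s -> vertical s ->
       exists! t, [/\ stitches_of L t, t <> s & latitude R t = latitude R s])).
Proof.
have [lew eqw] := length_extent R true L w w_ge1 L_loop L_width.
have [leh eqh] := length_extent R false L h h_ge1 L_loop L_height.
split; first by rewrite maxnMr geq_max lew leh.
split=> [hw|wh].
  by rewrite (maxn_idPl hw) eqw.
rewrite (maxn_idPr wh) eqh; split=> H s sL.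
  by move=> /negbTE; exact: H.
by move=> so; apply: H; rewrite // /vertical so.
Qed.
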